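(* Let $X$ be an infinite, non-discrete Fréchet–Urysohn space. The hyperspace $\mathcal{S}_c(X)$ of nontrivial convergent sequences of $X$, with the Vietoris topology, is locally connected if and only if $X$ is locally connected.
   Context: For a topological space $X$, $\mathcal{CL}(X)$ denotes the set of all nonempty closed subsets of $X$. For a nonempty family $\mathcal{U}$ of subsets of $X$, $\langle \mathcal{U}\rangle = \{F \in \mathcal{CL}(X) : F \subseteq \bigcup \mathcal{U} \text{ and } F \cap U \neq \emptyset \text{ for all } U \in \mathcal{U}\}$. The Vietoris topology on $\mathcal{CL}(X)$ has as a base the sets $\langle \mathcal{U}\rangle$, where $\mathcal{U}$ runs over all nonempty finite families of nonempty open subsets of $X$; every subset of $\mathcal{CL}(X)$ carries the subspace topology. A nontrivial convergent sequence of $X$ is a subset $S \subseteq X$ such that $|S| = \omega$ (countably infinite), $S$ has a unique non-isolated point $x_S$, and $S \setminus U$ is finite for each neighborhood $U$ of $x_S$. Then $\mathcal{S}_c(X) = \{S \in \mathcal{CL}(X) : S \text{ is a nontrivial convergent sequence}\}$. A space $X$ is Fréchet–Urysohn if whenever $A\subseteq X$ and $x \in \overline{A}$, there is a sequence of points of $A$ converging to $x$.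
   Formalization: The space X is assumed to be Hausdorff; without a separation axiom the claim fails, e.g. for the product of the rationals with a two-point indiscrete space, where the hyperspace of nontrivial convergent sequences is empty but X is not locally connected. *)

(* Defs.v *)
From HB Require Import structures.
From mathcomp Require Import all_boot all_order all_algebra.
From mathcomp Require Import all_classical topology.

Set Implicit Arguments.
Unset Strict Implicit.
Unset Printing Implicit Defensive.

Local Open Scope classical_set_scope.

Definition nonempty_closed (X : topologicalType) : set (set X) :=
  [set F | F !=set0 /\ closed F].
Arguments nonempty_closed : clear implicits.

(* A separate constant, so that the only topology found on [CL X] is the
   Vietoris one, not a topology inherited from [set X = (X -> Prop)]. *)
Definition CL (X : topologicalType) : Type := set_type (nonempty_closed X).

HB.instance Definition _ (X : topologicalType) :=
  Choice.copy (CL X) (set_type (nonempty_closed X)).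

Definition CL_val (X : topologicalType) (F : CL X) : set X := set_val F.

(* This is <U>. *)
Definition vietoris_base (X : topologicalType) (U : set (set X)) : set (CL X) :=
  [set F | CL_val F `<=` \bigcup_(V in U) V /\
           forall V, U V -> CL_val F `&` V !=set0].

Definition vietoris_index (X : topologicalType) : set (set (set X)) :=
  [set U | [/\ finite_set U, U !=set0 &
               forall V, U V -> open V /\ V !=set0]].
Arguments vietoris_index : clear implicits.

Lemma vietoris_cover (X : topologicalType) :
  \bigcup_(U in vietoris_index X) vietoris_base U = setT.
Proof.
rewrite predeqE => F; split=> // _.
have [[x Fx] _] : nonempty_closed X (CL_val F) by exact: set_valP.
exists [set setT].
  split; [exact: finite_set1 | by exists setT | move=> _ ->].
  by split; [exact: openT | exists x].
split=> [y _|_ ->]; first by exists setT.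
by rewrite setIT; exists x.
Qed.

Lemma vietoris_join (X : topologicalType) (U V : set (set X)) (F : CL X) :
  vietoris_index X U -> vietoris_index X V ->
  vietoris_base U F -> vietoris_base V F ->
  exists W, [/\ vietoris_index X W, vietoris_base W F &
                vietoris_base W `<=` vietoris_base U `&` vietoris_base V].
Proof.
move=> [finU [A0 UA0] opU] [finV _ opV] [FU Umeet] [FV Vmeet].
exists ([set A `&` \bigcup_(B in V) B | A in U] `|`
        [set A `&` \bigcup_(B in U) B | A in V]).
have W_meet C : ([set A `&` \bigcup_(B in V) B | A in U] `|`
    [set A `&` \bigcup_(B in U) B | A in V]) C -> CL_val F `&` C !=set0.
  case=> -[A UA <-].
    by have [x [Fx Ax]] := Umeet _ UA; exists x; do !split=> //; exact: FV.
  by have [x [Fx Ax]] := Vmeet _ UA; exists x; do !split=> //; exact: FU.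
split.
- split.
  + by rewrite finite_setU; split; exact: finite_image.
  + by exists (A0 `&` \bigcup_(B in V) B); left; exists A0.
  + move=> C WC; split; last by have [x [_ Cx]] := W_meet C WC; exists x.
    case: WC => -[A UA <-]; apply: openI.
    * by have [] := opU _ UA.
    * by apply: bigcup_open => B /opV[].
    * by have [] := opV _ UA.
    * by apply: bigcup_open => B /opU[].
- split=> // x Fx; have [A UA Ax] := FU _ Fx.
  exists (A `&` \bigcup_(B in V) B); first by left; exists A.
  by split=> //; exact: FV.
- move=> G [GW Gmeet]; split; split.
  + move=> x /GW[_ [[A UA <-] [Ax _]|[A _ <-] [_ //]]].
    by exists A.
  + move=> A UA; have [|x [Gx [Ax _]]] := Gmeet (A `&` \bigcup_(B in V) B).
      by left; exists A.
    by exists x.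
  + move=> x /GW[_ [[A _ <-] [_ //]|[A VA <-] [Ax _]]].
    by exists A.
  + move=> A VA; have [|x [Gx [Ax _]]] := Gmeet (A `&` \bigcup_(B in U) B).
      by right; exists A.
    by exists x.
Qed.

HB.instance Definition _ (X : topologicalType) :=
  isBaseTopological.Build (CL X) (@vietoris_cover X) (@vietoris_join X).

(* [isolated S] is the set of isolated points of the subspace [S]. *)
Definition nontrivial_convergent_sequence (X : topologicalType) (S : set X) :=
  (S #= [set: nat])%card /\
  exists x, S `\` isolated S = [set x] /\
            forall U, nbhs x U -> finite_set (S `\` U).

(* Coerced to a type, a set carries the subspace topology. *)
Definition Sc (X : topologicalType) : set (CL X) :=
  [set S | nontrivial_convergent_sequence (CL_val S)].
Arguments Sc : clear implicits.

Definition frechet_urysohn (X : topologicalType) :=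
  forall (A : set X) (x : X), closure A x ->
    exists u : nat -> X, (forall n, A (u n)) /\ u @ \oo --> x.

Definition locally_connected (T : topologicalType) :=
  forall (x : T) (U : set T), nbhs x U ->
    exists V, [/\ open V, V x, connected V & V `<=` U].

(* Main.v *)
Require Import Defs.
From mathcomp Require Import all_boot all_order all_algebra.
From mathcomp Require Import all_classical topology.

Local Open Scope classical_set_scope.

(** In the Vietoris topology a sequence S is approximated by every sequence T
that stays in the same open sets and visits each of them; nothing forces T to
have its limit near the limit of S, and finitely many points can be added to S
or removed from it at will. Both implications rest on this freedom.

From X to the hyperspace. Since X is locally connected, the sets of the form
<U>, for U a finite family of connected open sets, are a base at every sequence
([locally_connected_Sc]), so it suffices that they are connected
([connected_spans]). Let two disjoint open sets P and Q cover <U>. When a point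
v moves in a member V of U, the sequence S + {v} depends continuously on v, so
it stays on one side; as V meets S, this side is the one of S. Hence adding
finitely many points of the union of U to a sequence never changes its side
([separation_add_finite]). Now let S be in P and R be in Q, and let y be the
limit of R. Then S + {y} is in P, and P contains a basic neighborhood <W> of it.
Choose a finite part F of S + {y} that meets each member of W, and V0 in W
with y in V0. The sequence F + (R /\ V0) is in <W>, hence in P. Adding to it
the finitely many points of R \ V0 gives R + F, which is therefore in P; but
R + F is also R with finitely many points added, hence in Q: contradiction.

From the hyperspace to X. Let x be a non-isolated point of an open set U. The
Frechet-Urysohn property gives a sequence S in U with limit x
([frechet_sequence_to]), and local connectedness gives a connected open set O of
sequences in U with S in O. Let Y be the union of the members of O; it is open,
as points can be added to sequences. Some basic set <W> with S in <W> is inside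
O; let F be a finite part of S that contains x and meets each member of W.
Every nonempty clopen part A of Y meets F. Indeed the members of O that meet A
form a nonempty clopen part of O, so all of them meet A; but if A were disjoint
from F, then S \ A would be a sequence in <W>, hence in O, that misses A. A
space in which every nonempty clopen set meets one finite set has finitely many
clopen pieces, so the piece of x in Y is connected and open
([open_connected_piece]). *)

(** * Connected sets and clopen pieces *)

(** The open-cover form of connectedness suits the hyperspace, where membership
in a set and in its complement are both described by open conditions. *)
Lemma connected_openP (T : topologicalType) (K : set T) :
  connected K <->
  forall A B, open A -> open B -> K `<=` A `|` B -> K `&` A `&` B `<=` set0 ->
    K `&` A !=set0 -> K `<=` A.
Proof.
split=> [Kconn A B oA oB KAB AB0 KA0|Ksplit A A0 [C oC AKC] [D cD AKD]].
  have KAE : K `&` A = K.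
    apply: Kconn => //; first by exists A.
    exists (~` B); first exact: open_closedC.
    apply/seteqP; split=> t [Kt].
      by move=> At; split=> // /(conj (conj Kt At))/AB0.
    by move=> nBt; split=> //; case: (KAB _ Kt).
  by move=> t; rewrite -{1}KAE => -[].
rewrite AKC; apply/seteqP; split=> [t []//|t Kt]; split=> //; move: t Kt.
have memDC t : K t -> D t <-> C t.
  move=> Kt; have [AC CA] := (AKC, AKD).
  have : (K `&` C) t <-> (K `&` D) t by rewrite -AC -CA.
  move=> [CD DC]; split=> h; first by have [] := DC (conj Kt h).
  by have [] := CD (conj Kt h).
apply: (Ksplit _ (~` D)) => //; first exact: closed_openC.
- move=> t Kt; have [Dt|nDt] := pselect (D t); [left|by right].
  by apply/memDC.
- by move=> t [[Kt Ct]]; apply; apply/memDC.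
- by rewrite -AKC.
Qed.

Lemma nbhs_bigcap_finite (T : topologicalType) (I : choiceType) (D : set I)
    (f : I -> set T) (x : T) :
  finite_set D -> (forall i, D i -> nbhs x (f i)) -> nbhs x (\bigcap_(i in D) f i).
Proof.
move=> /finite_fsetP[E ->] fE; apply: filter_bigI => i iE; exact: fE.
Qed.

(** The piece of x is the intersection of clopen sets A f, one for each f in F,
where A f separates x from f whenever this is possible. If this intersection
split in two, the part without x would contain some f in F, and the other part
would separate x from f, so f would not have been in A f. *)
Lemma open_connected_piece (T : topologicalType) (Y F : set T) (x : T) :
  open Y -> finite_set F -> Y x ->
  (forall A, open A -> A `<=` Y -> open (Y `\` A) -> A !=set0 ->
     F `&` A !=set0) ->
  exists A, [/\ open A, A x, connected A & A `<=` Y].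
Proof.
move=> oY finF Yx clopF.
pose separates A f := [/\ open A, A `<=` Y, open (Y `\` A), A x & ~ A f].
have /choice[A Asep] f : exists A,
    [/\ open A, A `<=` Y, open (Y `\` A), A x &
        forall B, separates B f -> separates A f].
  have [[B sepB]|nosep] := pselect (exists B, separates B f).
    by exists B; case: (sepB).
  exists Y; split=> //; first by rewrite setDv; exact: open0.
  by move=> B sepB; case: nosep; exists B.
pose P := Y `&` \bigcap_(f in F) A f.
have oP : open P.
  apply: openI => //; rewrite openE => t At; apply: nbhs_bigcap_finite => // f Ff.
  by apply: open_nbhs_nbhs; split; [case: (Asep f)|exact: At].
have oYP : open (Y `\` P).
  suff -> : Y `\` P = \bigcup_(f in F) (Y `\` A f).
    by apply: bigcup_open => f _; case: (Asep f).
  apply/seteqP; split=> t.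
    move=> [Yt nPt]; apply: contrapT => nA; apply: nPt; split=> // f Ff.
    by apply: contrapT => nAft; apply: nA; exists f.
  by move=> [f Ff [Yt nAft]]; split=> // -[_] /(_ f Ff).
have Px : P x by split=> // f _; case: (Asep f).
(* Otherwise P \ Q would meet F, in a point that Q separates from x. *)
have xpart Q : open Q -> Q `<=` P -> open (P `\` Q) -> Q x -> P `<=` Q.
  move=> oQ QP oPQ Qx t Pt; apply: contrapT => nQt.
  have [|||f [Ff [Pf nQf]]] := clopF (P `\` Q) oPQ.
  - by move=> s [[]].
  - suff -> : Y `\` (P `\` Q) = (Y `\` P) `|` Q by apply: openU.
    apply/seteqP; split=> s.
      move=> [Ys nPQs]; have [Qs|nQs] := pselect (Q s); [by right|left].
      by split=> // Ps; apply: nPQs.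
    case=> [[Ys nPs]|Qs]; first by split=> // -[].
    by split; [have [] := QP _ Qs|case].
  - by exists t.
  have [_ _ _ _] := Asep f; move=> /(_ Q) [].
    split=> //; first by move=> s /QP[].
    suff -> : Y `\` Q = (Y `\` P) `|` (P `\` Q) by apply: openU.
    apply/seteqP; split=> s.
      by move=> [Ys nQs]; have [Ps|nPs] := pselect (P s); [right|left].
    by case=> [[Ys nPs]|[[Ys _] nQs]]; split=> // /QP.
  by move=> _ _ _ _; apply; have [_] := Pf; exact.
exists P; split=> //; last by move=> t [].
apply/connected_openP => A1 A2 oA1 oA2 cov dis [t [Pt A1t]].
have cmpl B1 B2 : P `<=` B1 `|` B2 -> P `&` B1 `&` B2 `<=` set0 ->
    P `\` (P `&` B1) = P `&` B2.
  move=> cv ds; apply/seteqP; split=> s.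
    by move=> [Ps nB]; split=> //; case: (cv _ Ps) => // B1s; case: nB.
  by move=> [Ps B2s]; split=> // -[_ B1s]; apply: (ds s).
have [A1x|A2x] := cov x Px.
  have := xpart (P `&` A1); rewrite (cmpl _ A2)// => h s Ps.
  by have [] := h (openI oP oA1) (@subIsetl _ _ _) (openI oP oA2) (conj Px A1x) s Ps.
have := xpart (P `&` A2); rewrite (cmpl _ A1)//.
- move=> h; have [_ A2t] :=
    h (openI oP oA2) (@subIsetl _ _ _) (openI oP oA1) (conj Px A2x) t Pt.
  by have := dis t (conj (conj Pt A1t) A2t).
- by move=> s /cov []; [right|left].
- by move=> s [[Ps A2s] A1s]; apply: (dis s).
Qed.

Lemma finite_meeting_set (T : Type) (S : set T) (U : set (set T)) :
  finite_set U -> (forall V, U V -> S `&` V !=set0) ->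
  exists F, [/\ finite_set F, F `<=` S & forall V, U V -> F `&` V !=set0].
Proof.
move=> finU SU.
have [[V UV]|U0] := pselect (U !=set0); last first.
  exists set0; split=> //.
  by move=> V UV; case: U0; exists V.
have [y _] := SU _ UV.
have /choice[w wP] W : exists t, U W -> (S `&` W) t.
  have [/SU[t St]|nUW] := pselect (U W); first by exists t.
  by exists y.
exists (w @` U); split=> [|_ [W /wP[SW _] <-]//|W UW]; first exact: finite_image.
by exists (w W); split; [exists W|have [] := wP _ UW].
Qed.

(** * Nontrivial convergent sequences *)

Section ConvergentSequences.
Context {X : topologicalType} (hX : hausdorff_space X).
Implicit Types (S : set X) (x : X).

(** In a Hausdorff space this amounts to S being a nontrivial convergent sequence
with limit x. It makes no reference to isolated points or closedness, so that it
can be checked after a finite modification of S. *)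
Definition sequence_to S x :=
  [/\ infinite_set S, countable S, S x & forall U, nbhs x U -> finite_set (S `\` U)].

Lemma separate_points x y : x <> y ->
  exists P Q, [/\ nbhs x P, nbhs y Q & P `&` Q = set0].
Proof.
move=> /eqP xy; move: hX; rewrite open_hausdorff => /(_ _ _ xy).
move=> [[P Q] /= [/set_mem Px /set_mem Qy] [oP oQ /eqP PQ]].
by exists P, Q; split=> //; exact: open_nbhs_nbhs.
Qed.

Lemma nbhs_setC_finite (F : set X) x : finite_set F -> ~ F x -> nbhs x (~` F).
Proof.
move=> finF nFx; apply: open_nbhs_nbhs; split=> //; apply: closed_openC.
exact: (accessible_finite_set_closed.1 (hausdorff_accessible hX)) finF.
Qed.

Lemma sequence_to_closed_nts S x : sequence_to S x ->
  nonempty_closed X S /\ nontrivial_convergent_sequence S.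
Proof.
move=> [infS cntS Sx convS].
(* A point y <> x has a neighborhood that meets S in at most y itself. *)
have away y : y <> x -> nbhs y [set z | S z -> z = y].
  move=> /separate_points[Q [P [Qy Px QP0]]].
  have finSP : finite_set ((S `\` P) `\ y) by apply: finite_setD; exact: convS.
  have : nbhs y (Q `&` ~` ((S `\` P) `\ y)).
    by apply: filterI => //; apply: nbhs_setC_finite => // -[_]; exact.
  apply: filterS.
  move=> z [Qz nSPz] Sz; apply: contrapT => zy; apply: nSPz; split=> //.
  by split=> // Pz; have : (Q `&` P) z by []; rewrite QP0.
split.
  split; first by exists x.
  move=> y clSy; have [->//|/away nyS] := pselect (y = x).
  by have [z [Sz zy]] := clSy _ nyS; rewrite -(zy Sz).
split; first exact: eq_card_nat.
exists x; split=> //; apply/seteqP; split=> [y [Sy nisoy]|_ ->].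
  apply: contrapT => /away nyS; apply: nisoy; split; first exact/mem_set.
  exists [set z | S z -> z = y] => //.
  by apply/seteqP; split=> [z [zy /zy]//|_ ->]; split.
split=> // -[_ [V Vx VSx]]; apply: infS.
have finV := convS V Vx.
rewrite -(setUIDK S V); rewrite finite_setU; split=> //.
by rewrite setIC VSx; exact: finite_set1.
Qed.

Lemma nts_sequence_to S : nontrivial_convergent_sequence S ->
  exists x, sequence_to S x.
Proof.
move=> [cardS [x [isoS convS]]]; exists x; split=> //.
- by rewrite (eq_finite_set cardS); exact: infinite_nat.
- by rewrite (eq_countable cardS); exact: countableP.
- by have : [set x] x by []; rewrite -isoS => -[].
Qed.

(** All conditions but membership of the limit are insensitive to a finite change;
this is what allows points to be added to sequences and removed from them. *)
Lemma sequence_to_eqmod_finite S T x : sequence_to S x -> T x ->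
  finite_set (S `\` T) -> finite_set (T `\` S) -> sequence_to T x.
Proof.
move=> [infS cntS Sx convS] Tx finST finTS; split=> //.
- move=> finT; apply: infS; rewrite -(setUIDK S T); rewrite finite_setU; split=> //.
  exact: sub_finite_set finT.
- have : countable (\bigcup_(b in [set: bool]) (if b then S else T `\` S)).
    apply: bigcup_countable; first exact: countableP.
    by move=> [] _ //; exact: finite_set_countable.
  apply: sub_countable; apply: subset_card_le => t Tt.
  by have [St|nSt] := pselect (S t); [exists true|exists false].
- move=> U /convS finU; apply: (@sub_finite_set _ _ ((S `\` U) `|` (T `\` S))).
    by move=> t [Tt nUt]; have [St|nSt] := pselect (S t); [left|right].
  by rewrite finite_setU.
Qed.

Lemma frechet_sequence_to (U : set X) x : frechet_urysohn X -> nbhs x U ->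
  ~ open [set x] -> exists2 S, sequence_to S x & S `<=` U.
Proof.
move=> fuX xU nisox.
have clUx : closure (U `\ x) x.
  move=> V xV; apply: contrapT => UV0; apply: nisox.
  rewrite openE => _ ->; apply: filterS (filterI xU xV) => y [Uy Vy].
  by apply: contrapT => yx; apply: UV0; exists y.
have [u [uU ux]] := fuX _ _ clUx.
have convu V : nbhs x V -> finite_set (range u `\` V).
  move=> /ux[N _ uN]; apply: (@sub_finite_set _ _ (u @` `I_N)).
    move=> _ [[n _ <-] nVn]; exists n => //=; rewrite ltnNge; apply/negP => Nn.
    by apply: nVn; exact: uN.
  by apply: finite_image; exact: finite_II.
exists (x |` range u); last first.
  by move=> _ [->|[n _ <-]]; [exact: nbhs_singleton|case: (uU n)].
split.
- move=> /(sub_finite_set (@subsetUr _ _ _)) finu.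
  have /ux[N _ uN] : nbhs x (~` range u).
    by apply: nbhs_setC_finite => // -[n _ unx]; have [_] := uU n; exact.
  by apply: (uN N) => //=; exists N.
- have : countable ((fun n => if n is n'.+1 then u n' else x) @` [set: nat]).
    by apply: sub_countable (card_image_le _ _) _; exact: countableP.
  apply: sub_countable; apply: subset_card_le => _ [->|[n _ <-]].
    by exists 0%N.
  by exists n.+1.
- by left.
- move=> V xV; rewrite setDUl; rewrite finite_setU; split; last exact: convu.
  exact: sub_finite_set (@subDsetl _ _ _) (finite_set1 x).
Qed.

End ConvergentSequences.

(** * The hyperspace of sequences *)

Section Hyperspace.
Context {X : topologicalType}.
Implicit Types (s t : set_type (Sc X)) (U : set (set X)) (S : set X).

Definition points s : set X := CL_val (set_val s).

(** The condition that defines <U>, for a subset of X instead of a point of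
[CL X]. *)
Definition spans U S := S `<=` \bigcup_(V in U) V /\ forall V, U V -> S `&` V !=set0.

Lemma points_inj s t : points s = points t -> s = t.
Proof. by move=> /val_inj/val_inj. Qed.

(** The subspace and the Vietoris topology unfolded at once, so that open sets of
sequences can be handled through subsets of X only. *)
Lemma open_ScP (O : set (set_type (Sc X))) :
  open O <-> forall s, O s -> exists U,
    [/\ vietoris_index X U, spans U (points s) &
        forall t, spans U (points t) -> O t].
Proof.
split=> [[P [D /= DU <-] <-] s [U DU' Us]|OU].
  exists U; split=> //; first exact: DU.
  by move=> t Ut; exists U.
pose D := [set U | vietoris_index X U /\ forall t, spans U (points t) -> O t].
exists (\bigcup_(U in D) @vietoris_base X U).
  by exists D => // U [].
apply/seteqP; split=> [s [U [_ UO] /UO//]|s /OU[U [idU Us UO]]].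
by exists U.
Qed.

Lemma open_spans U : vietoris_index X U -> open [set s | spans U (points s)].
Proof. by move=> idU; apply/open_ScP => s Us; exists U. Qed.

Lemma open_meets (A : set X) : open A -> open [set s | points s `&` A !=set0].
Proof.
move=> oA; apply/open_ScP => s [x [sx Ax]]; exists [set setT; A]; split.
- split; [exact: finite_set2|by exists A; right|move=> _ [->|->]]; split=> //.
  + exact: openT.
  + by exists x.
  + by exists x.
- split=> [y _|_ [->|->]]; [by exists setT => //; left|by exists x|by exists x].
- by move=> t [_]; apply; right.
Qed.

Lemma open_inside (A : set X) : open A -> open [set s | points s `<=` A].
Proof.
move=> oA; apply/open_ScP => s sA; have [[x sx] _] := set_valP (set_val s).
exists [set A]; split.
- split; [exact: finite_set1|by exists A|move=> _ ->]; split=> //.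
  by exists x; exact: sA.
- by split=> [y /sA Ay|_ ->]; [exists A|exists x; split=> //; exact: sA].
- by move=> t [tA _] y /tA[_ ->].
Qed.

Lemma points_sequence_to s : exists x, sequence_to (points s) x.
Proof. by apply: nts_sequence_to; exact: (set_valP s). Qed.

Lemma sequence_to_points S x : hausdorff_space X -> sequence_to S x ->
  exists s, points s = S.
Proof.
move=> hX /(sequence_to_closed_nts hX)[clS ntsS].
have cS : Sc X (SigSub (mem_set clS) : CL X) by [].
by exists (SigSub (mem_set cS)).
Qed.

Lemma spansU U S (G : set X) : spans U S -> G `<=` \bigcup_(V in U) V ->
  spans U (S `|` G).
Proof.
move=> [SU US] GU; split=> [x [/SU|/GU]//|V /US[x [Sx Vx]]].
by exists x; split=> //; left.
Qed.

Context (hX : hausdorff_space X).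

Lemma add_finite_points s (G : set X) : finite_set G ->
  exists t, points t = points s `|` G.
Proof.
move=> finG; have [x sx] := points_sequence_to s.
apply: (@sequence_to_points _ x) => //.
apply: (sequence_to_eqmod_finite _ _ _ sx).
- by left; have [] := sx.
- by rewrite setDUr setDv set0I; exact: finite_set0.
- by rewrite setDUl setDv set0U; exact: finite_setD.
Qed.

(** Continuity of v |-> S + {v}: if S + {v} is in <W>, then v can move inside the
intersection of the members of W that contain it. *)
Lemma open_preimage_add s (add : X -> set_type (Sc X)) (O : set (set_type (Sc X))) :
  (forall v, points (add v) = points s `|` [set v]) -> open O ->
  open (add @^-1` O).
Proof.
move=> addE /open_ScP oO; rewrite openE => v /oO[W [[finW _ oW]]].
rewrite addE => -[cov meet] WO.
have finWv : finite_set (W `&` [set V | V v]).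
  exact: sub_finite_set (@subIsetl _ _ _) finW.
have : nbhs v (\bigcap_(V in W `&` [set V | V v]) V).
  apply: nbhs_bigcap_finite => // V [WV Vv]; apply: open_nbhs_nbhs; split=> //.
  by have [] := oW _ WV.
apply: filterS => z zW; apply: WO; rewrite addE; split.
  move=> y [sy|->]; first by apply: cov; left.
  by have [V WV Vv] := cov v (or_intror erefl); exists V => //; exact: zW.
move=> V WV; have [y [[sy|yv] Vy]] := meet _ WV.
  by exists y; split=> //; left.
by exists z; split; [right|apply: zW; split=> //=; rewrite -yv].
Qed.

(** * Connected basic sets *)

Section Separation.
Context (U : set (set X)) (P Q : set (set_type (Sc X)))
  (Uconn : forall V, U V -> connected V) (oP : open P) (oQ : open Q)
  (cov : [set s | spans U (points s)] `<=` P `|` Q)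
  (dis : [set s | spans U (points s)] `&` P `&` Q `<=` set0).

(** The map z |-> S + {z} sends the connected set V into <U>, and sends a point of S
in V to S itself. *)
Lemma separation_add_point s t V v : spans U (points s) -> P s -> U V -> V v ->
  points t = points s `|` [set v] -> P t.
Proof.
move=> Us Ps UV Vv tE.
have /choice[add addE] z : exists t, points t = points s `|` [set z].
  exact/add_finite_points/finite_set1.
have addU z : V z -> spans U (points (add z)).
  by move=> Vz; rewrite addE; apply: spansU => // _ ->; exists V.
have <- : add v = t by apply: points_inj; rewrite addE.
have /connected_openP/(_ (add @^-1` P) (add @^-1` Q)) := Uconn _ UV.
apply=> //.
- exact: open_preimage_add.
- exact: open_preimage_add.
- by move=> z /addU/cov.
- by move=> z [[/addU Uz Pz] Qz]; apply: (dis (add z)).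
- have [p [sp Vp]] := Us.2 _ UV; exists p; split=> //=.
  suff -> : add p = s by [].
  by apply: points_inj; rewrite addE; apply: setUidl => _ ->.
Qed.

Lemma separation_add_finite s t (G : set X) : finite_set G ->
  G `<=` \bigcup_(V in U) V -> spans U (points s) -> P s ->
  points t = points s `|` G -> P t.
Proof.
move=> /finite_seqP[l ->]; elim: l s => [|v l IH] s lU Us Ps tE.
  suff -> : t = s by [].
  by apply: points_inj; rewrite tE; apply/seteqP; split=> [x []//|x]; left.
have [V UV Vv] : (\bigcup_(V in U) V) v by apply: lU => /=; rewrite inE eqxx.
have [r rE] := add_finite_points s _ (finite_set1 v).
apply: (IH r).
- by move=> x /= xl; apply: lU => /=; rewrite inE xl orbT.
- by rewrite rE; apply: spansU => // _ ->; exists V.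
- exact: (separation_add_point s r V v).
- rewrite tE rE -setUA; congr (_ `|` _); apply/seteqP; split=> x /=.
    by rewrite inE => /orP[/eqP ->|]; [left|right].
  by rewrite inE => -[->|->]; rewrite ?eqxx ?orbT.
Qed.

End Separation.

(** The limit y of a sequence r in Q is first added to a sequence s in P. The
resulting t has a neighborhood <W> in P, which then contains a sequence q with
limit y; and q differs from r by finitely many points. *)
Lemma connected_spans U : vietoris_index X U ->
  (forall V, U V -> connected V) -> connected [set s | spans U (points s)].
Proof.
move=> idU Uconn; apply/connected_openP => P Q oP oQ cov dis [s [Us Ps]] r Ur.
have [//|Qr] := cov _ Ur.
have [y ry] := points_sequence_to r; have [_ _ yr convr] := ry.
have Uy : [set y] `<=` \bigcup_(V in U) V by move=> _ ->; exact: Ur.1.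
have [t tE] := add_finite_points s _ (finite_set1 y).
have Ut : spans U (points t) by rewrite tE; exact: spansU.
have Pt : P t by apply: (separation_add_finite U P Q _ _ _ _ _ s) tE.
have /open_ScP/(_ t (conj Pt Ut))[W [[finW _ oW] Wt WP]] := openI oP (open_spans _ idU).
have [F [finF Ft FW]] := finite_meeting_set _ _ _ finW Wt.2.
have [V0 WV0 V0y] : (\bigcup_(V in W) V) y by apply: Wt.1; rewrite tE; right.
have nV0 : nbhs y V0.
  by apply: open_nbhs_nbhs; split=> //; have [] := oW _ WV0.
have finrV0 := convr _ nV0.
have [q qE] : exists q, points q = F `|` (points r `&` V0).
  apply: (@sequence_to_points _ y) => //.
  apply: (sequence_to_eqmod_finite _ _ _ ry); first by right.
    by apply: sub_finite_set finrV0 => z [rz nz]; split=> // ?; apply: nz; right.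
  by apply: sub_finite_set finF => z [[//|[rz _]]] /(_ rz).
have [Pq Uq] : P q /\ spans U (points q).
  apply: WP; rewrite qE; split=> [z [/Ft/Wt.1//|[_ V0z]]|V /FW[z [Fz Vz]]].
    by exists V0.
  by exists z; split=> //; left.
have [m mE] := add_finite_points r _ finF.
have FU : F `<=` \bigcup_(V in U) V by move=> z /Ft/Ut.1.
have Um : spans U (points m) by rewrite mE; exact: spansU.
exfalso; apply: (dis m); split; first split=> //.
  apply: (separation_add_finite U P Q _ _ _ _ _ q m (points r `\` V0)) => //.
    by move=> z [/Ur.1].
  by rewrite mE qE -setUA setUIDK setUC.
apply: (separation_add_finite U Q P _ _ _ _ _ r m F) => //.
- by move=> z /cov[]; [right|left].
- by move=> z [[Uz Qz] Pz]; apply: (dis z).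
Qed.

(** * Transfer of local connectedness *)

(** Each point z has a connected neighborhood C z inside all the members of W that
contain z. Finitely many of these suffice to trap the sequence s: that of its
limit, those of the points outside it, and those of points F that witness that s
meets each member of W. *)
Lemma locally_connected_Sc :
  locally_connected X -> locally_connected (set_type (Sc X)).
Proof.
move=> lcX s O; rewrite nbhsE => -[O' [/open_ScP oO' O's] O'O].
have [W [[finW _ oW] sW WO']] := oO' _ O's.
have [x sx] := points_sequence_to s; have [_ _ xs convs] := sx.
have /choice[C Cp] z : exists C,
    [/\ open C, C z, connected C & forall V, W V -> V z -> C `<=` V].
  have finWz : finite_set (W `&` [set V | V z]).
    exact: sub_finite_set (@subIsetl _ _ _) finW.
  have : nbhs z (\bigcap_(V in W `&` [set V | V z]) V).
    apply: nbhs_bigcap_finite => // V [WV Vz]; apply: open_nbhs_nbhs; split=> //.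
    by have [] := oW _ WV.
  move=> /lcX[C [oC Cz cC CV]]; exists C; split=> // V WV Vz y /CV yV; exact: yV.
have [F [finF Fs FW]] := finite_meeting_set _ _ _ finW sW.2.
pose D := x |` (F `|` (points s `\` C x)).
have Ds : D `<=` points s by move=> z [->//|[/Fs//|[sz _]]].
have finsC : finite_set (points s `\` C x).
  by apply: convs; apply: open_nbhs_nbhs; have [oC Cx _ _] := Cp x.
have idU : vietoris_index X (C @` D).
  split.
  - by apply: finite_image; rewrite !finite_setU; split=> //; exact: finite_set1.
  - by exists (C x), x => //; left.
  - by move=> _ [z _ <-]; have [oC Cz _ _] := Cp z; split=> //; exists z.
exists [set t | spans (C @` D) (points t)]; split.
- exact: open_spans.
- split=> [y sy|_ [z /Ds sz <-]]; last by exists z; split=> //; have [] := Cp z.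
  have [Cy|nCy] := pselect (C x y); first by exists (C x) => //; exists x => //; left.
  by exists (C y); [exists y => //; right; right|have [] := Cp y].
- by apply: connected_spans => // _ [z _ <-]; have [] := Cp z.
- move=> t [tU Ut]; apply: O'O; apply: WO'; split=> [y /tU[_ [z /Ds sz <-] Cy]|V WV].
    have [V WV Vz] := sW.1 z sz; exists V => //.
    by have [_ _ _ /(_ V WV Vz)] := Cp z; exact.
  have [z [Fz Vz]] := FW _ WV.
  have [|y [ty Cy]] := Ut (C z); first by exists z => //; right; left.
  exists y; split=> //.
  by have [_ _ _ /(_ V WV Vz)] := Cp z; exact.
Qed.

(** The union Y of a connected open set O of sequences near s has finitely many
clopen pieces, each of which meets the finite set x |` F of points that keep s
in O. *)
Lemma locally_connected_of_Sc : frechet_urysohn X ->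
  locally_connected (set_type (Sc X)) -> locally_connected X.
Proof.
move=> fuX lcSc x N; rewrite nbhsE => -[U [oU Ux] UN].
have [isox|nisox] := pselect (open [set x]).
  exists [set x]; split=> //; first exact: connected1.
  by move=> _ ->; exact: UN.
have xU : nbhs x U by apply: open_nbhs_nbhs; split.
have [S Sx SU] := frechet_sequence_to hX _ _ fuX xU nisox.
have [s sE] := sequence_to_points _ _ hX Sx.
have [_ _ xS convS] := Sx.
have sU : nbhs s [set t | points t `<=` U].
  by apply: open_nbhs_nbhs; split; [exact: open_inside|rewrite /= sE].
have [O [oO Os Oconn OU]] := lcSc _ _ sU.
have /open_ScP Obase := oO.
have [W [[finW _ _] Ws WO]] := Obase _ Os; rewrite sE in Ws.
have [F [finF FS FW]] := finite_meeting_set _ _ _ finW Ws.2.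
pose Y := \bigcup_(t in O) points t.
have oY : open Y.
  rewrite openE => y [t Ot ty]; have [W' [[_ _ oW'] W't W'O]] := Obase _ Ot.
  have [V W'V Vy] := W't.1 _ ty; have [oV _] := oW' _ W'V.
  apply: (@filterS _ _ _ V); last by apply: open_nbhs_nbhs; split.
  move=> z Vz; have [r rE] := add_finite_points t _ (finite_set1 z).
  exists r; last by rewrite rE; right.
  by apply: W'O; rewrite rE; apply: spansU => // _ ->; exists V.
have Yx : Y x by exists s => //; rewrite sE.
have finxF : finite_set (x |` F) by rewrite finite_setU; split=> //; exact: finite_set1.
have [|A [oA Ax Aconn AY]] := open_connected_piece _ _ _ _ oY finxF Yx; last first.
  by exists A; split=> // z /AY[t /OU tU /tU /UN].
move=> A oA AY oYA [a Aa]; apply: contrapT => FA0.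
(* The members of O inside Y `\` A are exactly those that miss A. *)
have meetA : O `<=` [set t | points t `&` A !=set0].
  have /connected_openP/(_ _ _ (open_meets _ oA) (open_inside _ oYA)) := Oconn.
  apply.
  - move=> t Ot; have [tA|tA] := pselect (points t `&` A !=set0); [by left|right].
    move=> z tz; split; first by exists t.
    by move=> Az; apply: tA; exists z.
  - by move=> t [[_ [z [tz Az]]] /(_ z tz)[]].
  - by have [t Ot ta] := AY _ Aa; exists t; split=> //; exists a.
have nAx : ~ A x by move=> Ax; apply: FA0; exists x; split=> //; left.
have [r rE] : exists r, points r = S `\` A.
  apply: (@sequence_to_points _ x) => //.
  apply: (sequence_to_eqmod_finite _ _ _ Sx) => //; last first.
    by apply: sub_finite_set (finite_set0 X) => z [[]].
  have : nbhs x (Y `\` A) by apply: open_nbhs_nbhs; split.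
  move=> /convS; apply: sub_finite_set => z [Sz nSA]; split=> // -[_ nAz].
  exact: nSA.
have /meetA[z [rz Az]] : O r.
  apply: WO; rewrite rE; split=> [z [/Ws.1]//|V /FW[z [Fz Vz]]].
  exists z; split=> //; split; first exact: FS.
  by move=> Az; apply: FA0; exists z; split=> //; right.
by rewrite rE in rz; case: rz.
Qed.

End Hyperspace.

Theorem corollary2p6 (X : topologicalType) (X_hausdorff : hausdorff_space X)
    (X_infinite : infinite_set [set: X])
    (X_nondiscrete : ~ (forall A : set X, open A))
    (X_frechet_urysohn : frechet_urysohn X) :
  locally_connected (set_type (Sc X)) <-> locally_connected X.
Proof.
split; [exact: locally_connected_of_Sc|exact: locally_connected_Sc].
Qed.
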